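(* Let $m$ be a positive integer, let $p$ be a prime with $\gcd(m,p)=1$, and let $s$ be a positive integer with $p^{s}\equiv 1 \pmod m$. Then for every positive integer $n$, $$f^{(m)}_{p^{s}-1+n}(x)\equiv f^{(m)}_{n}(x) \pmod p,$$ i.e. corresponding coefficients of the two polynomials are congruent modulo $p$.
   Context: For a positive integer $m$ let $\Psi_m(x)=\sum_{j=0}^{m-1}x^j=\frac{1-x^m}{1-x}$. For an integer $k\ge 0$ let $$f_k^{(m)}(x)=\left(\tfrac1m\, x\Psi_m'(x)\right)^k \ \mathrm{rem}\ \Psi_m(x)\in\mathbb{Q}[x],$$ where $u\ \mathrm{rem}\ v$ denotes the remainder of the division of the polynomial $u$ by $v$. Since $\Psi_m$ is monic, the coefficients of $f_k^{(m)}$ lie in $\mathbb{Z}[1/m]$, so they may be reduced modulo any prime $p$ not dividing $m$ (as elements of $\mathbb{F}_p$). *)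

(* Defs.v *)
From HB Require Import structures.
From mathcomp Require Import all_boot all_order all_algebra.
Set Implicit Arguments.
Unset Strict Implicit.
Unset Printing Implicit Defensive.
Import Order.TTheory GRing.Theory Num.Theory.
Local Open Scope ring_scope.

Definition Psi (m : nat) : {poly rat} := \sum_(j < m) 'X^j.

(* [Psi m] is nonzero for [0 < m], and over the field [rat] the operator [%%]
   is the genuine Euclidean remainder. *)
Definition fpow (m k : nat) : {poly rat} :=
  ((m%:R^-1 *: ('X * (Psi m)^`())) ^+ k) %% Psi m.

(* [ratr x : 'F_p] is numerator over denominator, computed in 'F_p.  When p
   divides the denominator it is the junk value 0, so the congruence also
   requires both sides to be p-integral. *)
Definition rat_eqmod (p : nat) (a b : rat) : Prop :=
  [/\ ~~ (p%:Z %| denq a)%Z, ~~ (p%:Z %| denq b)%Z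
    & ratr a = ratr b :> 'F_p].

Definition poly_eqmod (p : nat) (u v : {poly rat}) : Prop :=
  forall i : nat, rat_eqmod p u`_i v`_i.

(* Main.v *)
(** Over [F_p] put [q = p^s] and [g = m^-1 X Psi_m'].  Frobenius gives
    [g^q = g(X^q)], and [X^q = X] modulo [X^m - 1], hence modulo [Psi_m], because
    [q = 1] modulo [m].  So [g^q = g] modulo [Psi_m], and multiplying by
    [g^(n-1)] gives the periodicity.  It transfers to [f_k] because division by
    the monic [Psi_m] can be carried out over the integers, so that [f_k] is
    [m^-k] times an integer polynomial compatible with reduction modulo [p]. *)
Require Import Defs.
From HB Require Import structures.
From mathcomp Require Import all_boot all_order all_algebra.
From mathcomp Require Import finfield.
Set Implicit Arguments.
Unset Strict Implicit.
Unset Printing Implicit Defensive.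
Import Order.TTheory GRing.Theory Num.Theory Pdiv.Ring.
Local Open Scope ring_scope.

Definition psi (R : nzRingType) (m : nat) : {poly R} := \sum_(j < m) 'X^j.

Definition psi_power (F : fieldType) (m k : nat) : {poly F} :=
  ((m%:R^-1 *: ('X * (psi F m)^`())) ^+ k) %% psi F m.

(** The factor [m^-1] is left out to stay over [int]; it returns as the denominator [m ^ k] in
    [coef_psi_power]. *)
Definition int_psi_power (m k : nat) : {poly int} :=
  rmodp (('X * (psi int m)^`()) ^+ k) (psi int m).

Lemma psiE (R : nzRingType) m : psi R m = \poly_(j < m) 1.
Proof. by rewrite poly_def; apply: eq_bigr => j _; rewrite scale1r. Qed.

Lemma size_psi (R : nzRingType) m : size (psi R m) = m.
Proof.
case: m => [|m]; first by rewrite /psi big_ord0 size_poly0.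
by rewrite psiE size_poly_eq ?oner_neq0.
Qed.

Lemma psi_monic (R : nzRingType) m : (0 < m)%N -> psi R m \is monic.
Proof.
case: m => // m _; rewrite monicE lead_coefE size_psi psiE coef_poly.
by rewrite ltnSn.
Qed.

Lemma map_psi (R S : nzRingType) (f : {rmorphism R -> S}) m :
  map_poly f (psi R m) = psi S m.
Proof. by rewrite rmorph_sum; apply: eq_bigr => j _; rewrite /= map_polyXn. Qed.

(** If [q = d * m + 1], then ['X^q - 'X] is a multiple of ['X^m - 1], hence of [psi F m]. *)
Lemma psi_dvd_Xn_sub_X (F : fieldType) m q :
  q = 1 %[mod m] -> psi F m %| 'X^q - 'X.
Proof.
case: q => [/eqP|q /eqP].
  (* The case [q = 0] forces [m = 1], where [psi F m] is 1. *)
  rewrite mod0n eq_sym -/(m %| 1)%N dvdn1 => /eqP->.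
  by rewrite /psi big_ord1 expr0 dvd1p.
rewrite -addn1 -[X in _ == X %[mod _]]add0n eqn_modDr mod0n => /dvdnP[d ->].
rewrite addn1 exprSr mulnC exprM -[X in _ - X]mul1r -mulrBl.
by rewrite dvdp_mulr // subrX1 dvdp_mulr // subrX1 dvdp_mull.
Qed.

Lemma psi_dvd_comp_Xn_sub (F : fieldType) m q (g : {poly F}) :
  q = 1 %[mod m] -> psi F m %| g \Po 'X^q - g.
Proof.
move=> q1; elim/poly_ind: g => [|g c IHg]; first by rewrite comp_poly0 subrr.
rewrite comp_polyD comp_polyM comp_polyX comp_polyC opprD addrACA subrr addr0.
(* Inserting the mixed term [(g \Po 'X^q) * 'X] leaves one multiple of ['X^q - 'X] and one of
   [g \Po 'X^q - g]. *)
rewrite -(subrK ((g \Po 'X^q) * 'X) (_ * 'X^q)) -mulrBr -addrA -mulrBl.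
by rewrite dvdp_add ?(dvdp_mulr _ IHg) ?dvdp_mull ?psi_dvd_Xn_sub_X.
Qed.

Lemma Fp_expr_pow (p s : nat) (x : 'F_p) : prime p -> x ^+ (p ^ s) = x.
Proof.
move=> pp; elim: s => [|s IHs]; first by rewrite expn0.
by rewrite expnS mulnC exprM IHs -[X in _ ^+ X](card_Fp pp) expf_card.
Qed.

Lemma Fp_poly_expr_pow (p s : nat) (g : {poly 'F_p}) :
  prime p -> g ^+ (p ^ s) = g \Po 'X^(p ^ s).
Proof.
move=> pp; have q_gt0 : (0 < p ^ s)%N by rewrite expn_gt0 prime_gt0.
elim/poly_ind: g => [|g c IHg].
  by rewrite comp_poly0 expr0n eqn0Ngt q_gt0.
have qchar : [pchar {poly 'F_p}].-nat (p ^ s)%N.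
  rewrite pnatX (pnatE _ pp) pchar_poly pchar_Fp //.
rewrite exprDn_pchar // exprMn IHg -polyC_exp Fp_expr_pow //.
by rewrite comp_polyD comp_polyM comp_polyX comp_polyC.
Qed.

Lemma psi_power_periodic (m p s n : nat) : prime p -> p ^ s = 1 %[mod m] ->
  (0 < n)%N ->
  psi_power 'F_p m (p ^ s - 1 + n)%N = psi_power 'F_p m n.
Proof.
move=> pp q1; case: n => // n _; rewrite /psi_power; set g := _ *: _.
(* As [n] is now a successor, the exponent splits as [p ^ s] plus the predecessor, against 1 plus
   the same predecessor. *)
rewrite addnS -addSn subn1 prednK ?expn_gt0 ?prime_gt0 // exprD exprS.
apply/eqP; rewrite -subr_eq0 -modpN -modpD -mulrBl; apply: dvdp_mulr.
by rewrite Fp_poly_expr_pow // psi_dvd_comp_Xn_sub.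
Qed.

(** Uniqueness of Euclidean division over [F]: a leading coefficient 1 survives [intr], so the image
    of [v] keeps its size and the remainder stays smaller. *)
Lemma map_rmodp_intr (F : fieldType) (u v : {poly int}) : v \is monic ->
  map_poly (intr : int -> F) (rmodp u v) = map_poly intr u %% map_poly intr v.
Proof.
move=> vmon; apply: (modpP (q := map_poly intr (rdivp u v))).
  by rewrite -rmorphM -rmorphD -Pdiv.RingMonic.rdivp_eq.
rewrite [X in (_ < X)%N]size_map_poly_id0; last first.
  by rewrite (eqP vmon) rmorph1 oner_eq0.
apply: leq_ltn_trans (size_poly _ _) _.
by rewrite ltn_rmodpN0 // monic_neq0.
Qed.

Lemma coef_psi_power (F : fieldType) m k i : (0 < m)%N ->
  (psi_power F m k)`_i = ((int_psi_power m k)`_i)%:~R / (m ^ k)%:R.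
Proof.
move=> m_gt0; rewrite /psi_power exprZn modpZl coefZ exprVn -natrX mulrC.
congr (_ / _); rewrite -(coef_map (intr : int -> F)) /=.
rewrite map_rmodp_intr ?psi_monic // map_psi rmorphXn rmorphM /=.
by rewrite map_polyX -deriv_map map_psi.
Qed.

Lemma numq_divn (a : int) (d : nat) : (0 < d)%N ->
  numq (a%:~R / d%:R) * d%:Z = a * denq (a%:~R / d%:R).
Proof.
move=> d_gt0; apply: (@intr_inj rat).
by rewrite !rmorphM /= numqE mulrAC divfK // pnatr_eq0 -lt0n.
Qed.

(** The denominator divides [numq * d] by [numq_divn] and is coprime to the numerator, so Gauss
    applies. *)
Lemma denq_divn_dvd (a : int) (d : nat) :
  (0 < d)%N -> (denq (a%:~R / d%:R) %| d%:Z)%Z.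
Proof.
move=> d_gt0; rewrite -(@Gauss_dvdzr _ (numq (a%:~R / d%:R))).
  by rewrite numq_divn // dvdz_mull.
by rewrite coprimezE coprime_sym coprime_num_den.
Qed.

Lemma ratr_Fp_divn (p d : nat) (a : int) : prime p -> coprime p d ->
  ~~ (p%:Z %| denq (a%:~R / d%:R))%Z
  /\ ratr (a%:~R / d%:R) = a%:~R / d%:R :> 'F_p.
Proof.
move=> pp co_pd.
have d_gt0 : (0 < d)%N.
  by case: d co_pd => //; rewrite /coprime gcdn0 => /eqP p1; rewrite p1 in pp.
have pNdvd : ~~ (p%:Z %| denq (a%:~R / d%:R))%Z.
  apply: contraL co_pd => /dvdz_trans/(_ (denq_divn_dvd a d_gt0)) pd.
  by rewrite prime_coprime // negbK.
split=> //; rewrite /ratr; apply/eqP.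
have nz_den : (denq (a%:~R / d%:R))%:~R != 0 :> 'F_p.
  by rewrite -(dvdz_pcharf (pchar_Fp pp)).
have nz_d : d%:R != 0 :> 'F_p.
  by rewrite -(dvdn_pcharf (pchar_Fp pp)) -prime_coprime.
(* With both denominators nonzero in ['F_p], cross-multiplying leaves the image of an integer
   identity. *)
rewrite eqr_div //; apply/eqP.
by have := congr1 (intr : int -> 'F_p) (numq_divn a d_gt0); rewrite !intrM.
Qed.

Theorem theorem4p1 (m p s : nat) (m_gt0 : (0 < m)%N) (p_prime : prime p)
  (co_mp : coprime m p) (s_gt0 : (0 < s)%N) (ps1 : p ^ s = 1 %[mod m])
  (n : nat) (n_gt0 : (0 < n)%N) :
  poly_eqmod p (fpow m (p ^ s - 1 + n)%N) (fpow m n).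
Proof.
move=> i.
have redE k : ~~ (p%:Z %| denq (fpow m k)`_i)%Z
    /\ ratr (fpow m k)`_i = (psi_power 'F_p m k)`_i.
  (* One integer numerator serves both fields, [rat] and ['F_p]. *)
  rewrite -[fpow m k]/(psi_power rat m k) !coef_psi_power //.
  by apply: ratr_Fp_divn; rewrite // coprimeXr // coprime_sym.
have [int1 eq1] := redE (p ^ s - 1 + n)%N; have [int2 eq2] := redE n.
by split=> //; rewrite eq1 eq2 psi_power_periodic.
Qed.
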